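(* Let $N$ be a positive integer, $\boldsymbol{k}=(k_1,\dots,k_r)$ an index with $r>1$, $\boldsymbol{x}=(x_1,\dots,x_r)$ indeterminates, and $1<i\le r$. When $k_{i-1}>1$ and $k_i>1$, \[ \frac{\Delta^{(N)}\widetilde{\mathrm{Li}}_{\boldsymbol{k}}^{\sqcup\!\sqcup,(N)}(\boldsymbol{x})}{\Delta^{(N)}x_i} = \frac{1}{x_i}\left(\widetilde{\mathrm{Li}}^{\sqcup\!\sqcup,(N)}_{\boldsymbol{k}^{\downarrow}_{i-1}}(\boldsymbol{x})\bigg|_{x_i+N^{-1}}-\widetilde{\mathrm{Li}}^{\sqcup\!\sqcup,(N)}_{\boldsymbol{k}^{\downarrow}_i}(\boldsymbol{x})\right); \] when $k_{i-1}>1$ and $k_i=1$, \begin{align*} \frac{\Delta^{(N)} \widetilde{\mathrm{Li}}_{\boldsymbol{k}}^{\sqcup\!\sqcup,(N)}(\boldsymbol{x})}{\Delta^{(N)} x_i} &= \frac{1}{x_i}\left(\widetilde{\mathrm{Li}}_{\boldsymbol{k}_{i-1}^\downarrow}^{\sqcup\!\sqcup,(N)}(\boldsymbol{x})\bigg|_{x_i+N^{-1}}+\widetilde{\mathrm{Li}}_{\boldsymbol{k}_i^\wedge}^{\sqcup\!\sqcup,(N)}(\boldsymbol{x}_i^\wedge)\right)\\ &\quad-\frac{1}{x_i+N^{-1}-x_{i+1}}\left(\widetilde{\mathrm{Li}}_{\boldsymbol{k}_i^\wedge}^{\sqcup\!\sqcup,(N)}(\boldsymbol{x}_i^\wedge)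 - \widetilde{\mathrm{Li}}_{\boldsymbol{k}_i^\wedge}^{\sqcup\!\sqcup,(N)}(\boldsymbol{x}_{i+1}^\wedge)\bigg|_{x_i+N^{-1}}\right)\\ &\quad-\frac{1}{N}\frac{1}{x_i(x_i+N^{-1}-x_{i+1})}\left(\widetilde{\mathrm{Li}}_{(\boldsymbol{k}_{i-1}^\downarrow)_i^\wedge}^{\sqcup\!\sqcup,(N)}(\boldsymbol{x}_{i+1}^\wedge)\bigg|_{x_i+N^{-1}} - \widetilde{\mathrm{Li}}_{(\boldsymbol{k}_{i-1}^\downarrow)_i^\wedge}^{\sqcup\!\sqcup,(N)}(\boldsymbol{x}_i^\wedge)\right); \end{align*} when $k_{i-1}=1$ and $k_i>1$, \begin{align*} \frac{\Delta^{(N)}\widetilde{\mathrm{Li}}_{\boldsymbol{k}}^{\sqcup\!\sqcup,(N)}(\boldsymbol{x})}{\Delta^{(N)}x_i}&=-\frac{1}{x_i-x_{i-1}} \left(\widetilde{\mathrm{Li}}_{\boldsymbol{k}_{i-1}^\wedge}^{\sqcup\!\sqcup,(N)}(\boldsymbol{x}_{i-1}^\wedge) - \widetilde{\mathrm{Li}}_{\boldsymbol{k}_{i-1}^\wedge}^{\sqcup\!\sqcup,(N)}(\boldsymbol{x}_i^\wedge) \right) - \frac{1}{x_i} \left(\widetilde{\mathrm{Li}}_{\boldsymbol{k}_{i-1}^\wedge}^{\sqcup\!\sqcup,(N)}(\boldsymbol{x}_i^\wedge) + \widetilde{\mathrm{Li}}_{\boldsymbol{k}_i^\downarrow}^{\sqcup\!\sqcup,(N)}(\boldsymbol{x})\right)\\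 &\quad-\frac{1}{N}\frac{1}{x_i(x_i-x_{i-1})}\left(\widetilde{\mathrm{Li}}_{(\boldsymbol{k}^{\downarrow}_i)^{\wedge}_{i-1}}^{\sqcup\!\sqcup,(N)}(\boldsymbol{x}^{\wedge}_i)-\widetilde{\mathrm{Li}}_{(\boldsymbol{k}^{\downarrow}_i)^{\wedge}_{i-1}}^{\sqcup\!\sqcup,(N)}(\boldsymbol{x}^{\wedge}_{i-1})\right); \end{align*} when $k_{i-1}=k_i=1$, \begin{align*} \frac{\Delta^{(N)} \widetilde{\mathrm{Li}}_{\boldsymbol{k}}^{\sqcup\!\sqcup,(N)}(\boldsymbol{x})}{\Delta^{(N)} x_i} &= -\frac{1}{x_i - x_{i-1}} \left(\widetilde{\mathrm{Li}}_{\boldsymbol{k}_{i-1}^\wedge}^{\sqcup\!\sqcup,(N)}(\boldsymbol{x}_{i-1}^\wedge) - \widetilde{\mathrm{Li}}_{\boldsymbol{k}_i^\wedge}^{\sqcup\!\sqcup,(N)} (\boldsymbol{x}_i^\wedge)\right) \\ &\quad- \frac{1}{x_i+N^{-1}-x_{i+1}} \left(\widetilde{\mathrm{Li}}_{\boldsymbol{k}_i^\wedge}^{\sqcup\!\sqcup,(N)}(\boldsymbol{x}_i^\wedge) - \widetilde{\mathrm{Li}}_{\boldsymbol{k}_i^\wedge}^{\sqcup\!\sqcup,(N)} (\boldsymbol{x}_{i+1}^\wedge)\bigg|_{x_i+N^{-1}} \right). \end{align*} For the case $i=r$, interpret $x_{r+1}=1$ and $\widetilde{\mathrm{Li}}_{\boldsymbol{k}_r^\wedge}^{\sqcup\!\sqcup,(N)}(\boldsymbol{x}_{r+1}^\wedge)\big|_{x_r+N^{-1}}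 = \widetilde{\mathrm{Li}}_{(\boldsymbol{k}_{r-1}^\downarrow)_r^\wedge}^{\sqcup\!\sqcup,(N)}(\boldsymbol{x}_{r+1}^\wedge)\big|_{x_r+N^{-1}}=0$.
   Context: Here $\sqcup\!\sqcup$ denotes the shuffle symbol. With $x_{r+1}\coloneqq1$, \[ \widetilde{\mathrm{Li}}_{\boldsymbol{k}}^{\sqcup\!\sqcup,(N)}(\boldsymbol{x})\coloneqq\sum_{0<n_1<\cdots<n_r<N}\frac{1}{n_1^{k_1}\cdots n_r^{k_r}}\prod_{i=1}^{r}\frac{\binom{Nx_{i+1}-1}{n_i}}{\binom{Nx_i-1}{n_i}}. \] The difference quotient is $\frac{\Delta^{(N)}f(\boldsymbol{x})}{\Delta^{(N)}x_i}\coloneqq N\bigl(f(x_1,\dots,x_i+N^{-1},\dots,x_r)-f(\boldsymbol{x})\bigr)$, and $f(\boldsymbol{x})\big|_{x_i+N^{-1}}$ means $f$ evaluated with $x_i$ replaced by $x_i+N^{-1}$. Notation: $\boldsymbol{k}^{\wedge}_i$ removes the $i$-th entry of $\boldsymbol{k}$; $\boldsymbol{k}^{\downarrow}_i$ replaces $k_i$ by $k_i-1$ (for $k_i>1$); $\boldsymbol{x}^{\wedge}_i$ removes the $i$-th entry of $\boldsymbol{x}$; compositions such as $(\boldsymbol{k}_{i-1}^\downarrow)_i^\wedge$ apply these operations successively. *)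

(* Defs.v *)
From HB Require Import structures.
From mathcomp Require Import all_boot all_order all_algebra fraction.
From mathcomp Require Import mpoly.

Set Implicit Arguments.
Unset Strict Implicit.
Unset Printing Implicit Defensive.

Import GRing.Theory.

Local Open Scope ring_scope.

(* Indices k and points x are sequences whose entries are numbered from 1. *)

Definition kat (k : seq nat) (i : nat) : nat := nth 0%N k i.-1.

(* The default value 1 gives x_(r+1) = 1 when x has length r. *)
Definition xat (F : fieldType) (x : seq F) (i : nat) : F := nth 1 x i.-1.

(* s^_i : removal of the i-th entry, for 1 <= i <= size s. *)
Definition remi (T : Type) (s : seq T) (i : nat) : seq T :=
  take i.-1 s ++ drop i s.

(* k_i is replaced by k_i - 1; only meant for 1 <= i <= size k and k_i > 1. *)
Definition deci (k : seq nat) (i : nat) : seq nat :=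
  set_nth 0%N k i.-1 (kat k i).-1.

(* x_i is replaced by x_i + 1/N, for 1 <= i <= size x. *)
Definition shifti (F : fieldType) (N : nat) (x : seq F) (i : nat) : seq F :=
  set_nth 1 x i.-1 (xat x i + N%:R^-1).

Definition gbin (F : fieldType) (a : F) (n : nat) : F :=
  (\prod_(j < n) (a - j%:R)) / n`!%:R.

(* The condition "path ltn 0 n" reads 0 < n_1 < ... < n_r, and n_r < N comes
   from the type of the entries; the ordinal j stands for the 1-based
   position j.+1. *)
Definition LiSh (F : fieldType) (N : nat) (k : seq nat) (x : seq F) : F :=
  \sum_(n : (size k).-tuple 'I_N | path ltn 0%N [seq val m | m <- n])
    (\prod_(j < size k) (tnth n j)%:R ^+ kat k j.+1)^-1 *
    \prod_(j < size k)
      (gbin (N%:R * xat x j.+2 - 1) (tnth n j) /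
       gbin (N%:R * xat x j.+1 - 1) (tnth n j)).

Definition diffq (F : fieldType) (N : nat) (f : seq F -> F) (x : seq F)
    (i : nat) : F :=
  N%:R * (f (shifti N x i) - f x).

(* Li_k (x^_(i+1)) at x_i + 1/N: the shift is applied first, since the i-th
   entry survives the removal. The value is 0 when i is the last position. *)
Definition LiSh_next (F : fieldType) (N : nat) (k : seq nat) (x : seq F)
    (i : nat) : F :=
  if (i < size x)%N then LiSh N k (remi (shifti N x i) i.+1) else 0.

(* The indeterminates x_1, ..., x_r, as elements of Q(x_1, ..., x_r). *)
Definition indets (r : nat) : seq {fraction {mpoly rat[r]}} :=
  [seq tofrac ('X_j : {mpoly rat[r]}) | j <- enum 'I_r].

(* Main.v *)
Require Import Defs.
From HB Require Import structures.
From mathcomp Require Import all_boot all_order all_algebra fraction.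
From mathcomp Require Import mpoly.
From mathcomp Require Import ring zify.

Set Implicit Arguments.
Unset Strict Implicit.
Unset Printing Implicit Defensive.

Import GRing.Theory.

Local Open Scope ring_scope.

(* Write C_t(n) for the binomial coefficient (t choose n), and X_j = N x_j. The
   sum is nested, and linear in its innermost part, so only the positions i-1
   and i matter. There, X_i enters through C_{X_i - 1}(a) / C_{X_i - 1}(b) with
   a = n_(i-1) < b = n_i, and (t - n) C_t(n) = t C_{t-1}(n) gives termwise the
   formula of the first case. If an exponent is 1, the formula still holds,
   with an index having an entry 0. The sum over that entry telescopes, since
   C_u(b) / C_v(b) is (up to the factor 1 / (u - v - 1)) the difference of
   (v + 1 - b) C_u(b) / C_v(b) at b + 1 and b. When k_(i-1) = k_i = 1 the
   remaining indices with entry 0 cancel, being divided differences. *)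

(** * Sequences split around a position *)

Lemma remi_cat1 (T : Type) (s1 s2 : seq T) a :
  remi (s1 ++ a :: s2) (size s1).+1 = s1 ++ s2.
Proof.
by rewrite /remi /= take_size_cat // -cat_rcons drop_size_cat ?size_rcons.
Qed.

Lemma remi_cat2 (T : Type) (s1 s2 : seq T) a b :
  remi (s1 ++ a :: b :: s2) (size s1).+2 = s1 ++ a :: s2.
Proof. by rewrite -cat_rcons -(size_rcons s1 a) remi_cat1 cat_rcons. Qed.

Lemma set_nth_cat1 (T : Type) x0 (s1 s2 : seq T) a b :
  set_nth x0 (s1 ++ a :: s2) (size s1) b = s1 ++ b :: s2.
Proof. by elim: s1 => //= c s1 ->. Qed.

Lemma set_nth_cat2 (T : Type) x0 (s1 s2 : seq T) a b c :
  set_nth x0 (s1 ++ a :: b :: s2) (size s1).+1 c = s1 ++ a :: c :: s2.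
Proof. by rewrite -cat_rcons -(size_rcons s1 a) set_nth_cat1 cat_rcons. Qed.

Lemma kat_cat1 s1 s2 a : kat (s1 ++ a :: s2) (size s1).+1 = a.
Proof. by rewrite /kat nth_cat ltnn subnn. Qed.

Lemma kat_cat2 s1 s2 a b : kat (s1 ++ a :: b :: s2) (size s1).+2 = b.
Proof. by rewrite -cat_rcons -(size_rcons s1 a) kat_cat1. Qed.

Lemma xat_cat2 (F : fieldType) (s1 s2 : seq F) a b :
  xat (s1 ++ a :: b :: s2) (size s1).+2 = b.
Proof. by rewrite /xat -cat_rcons -(size_rcons s1 a) nth_cat ltnn subnn. Qed.

Lemma seq_split2 (T : Type) (d : T) (s : seq T) i : (1 < i <= size s)%N ->
  s = take i.-2 s ++ nth d s i.-2 :: nth d s i.-1 :: drop i s.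
Proof.
case: i => [|[|i]] //= lt_is.
by rewrite -!drop_nth ?cat_take_drop // ltnW.
Qed.

(** * Generalized binomial coefficients in characteristic 0 *)

Section NestedSums.

Variables (F : fieldType) (N : nat).
Hypothesis char0 : forall n, n.+1%:R != 0 :> F.

Lemma gbin0 (a : F) : gbin a 0 = 1.
Proof. by rewrite /gbin big_ord0 fact0 divr1. Qed.

Lemma fact_neq0 n : n`!%:R != 0 :> F.
Proof. by case: n`! (fact_gt0 n) => // m _; exact: char0. Qed.

Lemma gbinS (a : F) n : n.+1%:R * gbin a n.+1 = (a - n%:R) * gbin a n.
Proof.
rewrite /gbin big_ord_recr /= factS natrM.
by field; rewrite fact_neq0 nat1r char0.
Qed.

Lemma gbin_pred (a : F) n : (a - n%:R) * gbin a n = a * gbin (a - 1) n.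
Proof.
rewrite /gbin !mulrA; congr (_ / _).
transitivity (\prod_(j < n.+1) (a - j%:R)); first by rewrite big_ord_recr mulrC.
rewrite big_ord_recl subr0; congr (_ * _); apply: eq_bigr => j _.
by rewrite lift0 -nat1r; ring.
Qed.

Lemma gbin_neq0 (a : F) n : (forall j : nat, a != j%:R) -> gbin a n != 0.
Proof.
move=> ha; rewrite /gbin mulf_neq0 ?invr_eq0 ?fact_neq0 //.
by apply/prodf_neq0 => j _; rewrite subr_eq0.
Qed.

Lemma gbin_pred_neq0 (a : F) n : (forall j : nat, a != j%:R) -> gbin (a - 1) n != 0.
Proof. by move=> ha; apply: gbin_neq0 => j; rewrite subr_eq natr1. Qed.

(* The boundary factor at [m] belongs to the preceding index in [LiSh]; it is put
   here to gather all that depends on [t]. The outermost one is 1, as [m = 0]. *)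
Definition nest (k : nat) (t : F) (f : nat -> F) (m : nat) : F :=
  gbin (t - 1) m *
  \sum_(m.+1 <= n < N) (n%:R ^+ k)^-1 / gbin (t - 1) n * f n.

(** * The sum as an iterated sum *)

(** The base case is the numerator carried by the last index; on an empty [x] the default of [head]
    makes it the binomial coefficient of N - 1, in accordance with x_(r+1) = 1. *)
Fixpoint nestLi (k : seq nat) (x : seq F) : nat -> F :=
  if k is k1 :: k' then nest k1 (N%:R * head 1 x) (nestLi k' (behead x))
  else gbin (N%:R * head 1 x - 1).

Lemma nat_sum_ord (u : nat -> F) m :
  \sum_(m.+1 <= n < N) u n = \sum_(n < N | (m < n)%N) u n.
Proof. by rewrite (big_nat_widenl _ 0%N) // big_mkord. Qed.

Lemma sum_cons_tuple (V : nmodType) (T : finType) s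
    (P : pred (s.+1.-tuple T)) (G : s.+1.-tuple T -> V) :
  \sum_(t | P t) G t =
  \sum_(a : T) \sum_(t : s.-tuple T | P (cons_tuple a t)) G (cons_tuple a t).
Proof.
rewrite pair_big_dep /=.
rewrite (reindex (fun p : T * s.-tuple T => cons_tuple p.1 p.2)) //=.
exists (fun t => (thead t, [tuple of behead t])) => [[a t]|t] _ /=.
  by rewrite theadE; congr pair; apply: val_inj.
by case/tupleP: t => a t; apply: val_inj; rewrite /= theadE.
Qed.

(** The lower bound 0 of [LiSh] is generalized to [m] so that induction applies once the smallest
    index is peeled off. *)
Lemma nestLi_sum k x m :
  nestLi k x m = gbin (N%:R * head 1 x - 1) m *
  \sum_(n : (size k).-tuple 'I_N | path ltn m [seq val m | m <- n])
    (\prod_(j < size k) (tnth n j)%:R ^+ kat k j.+1)^-1 *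
    \prod_(j < size k)
      (gbin (N%:R * xat x j.+2 - 1) (tnth n j) /
       gbin (N%:R * xat x j.+1 - 1) (tnth n j)).
Proof.
elim: k x m => [|k1 k IH] x m /=.
  rewrite (big_pred1 [tuple]) /=; last by move=> t; rewrite tuple0.
  by rewrite !big_ord0 invr1 !mulr1.
rewrite /nest; congr (_ * _); rewrite sum_cons_tuple nat_sum_ord.
rewrite [LHS]big_mkcond /=; apply: eq_bigr => a _.
case: ifP => [lt_ma|/negbT nlt_ma]; last first.
  by rewrite big_pred0 // => t; rewrite (negbTE nlt_ma).
rewrite IH [in RHS](eq_bigl (fun t : (size k).-tuple 'I_N =>
  path ltn a [seq val m | m <- t])) //.
rewrite !mulr_sumr; apply: eq_bigr => t _.
rewrite !big_ord_recl !tnth0 invfM /=.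
have tE j : tnth (cons_tuple a t) (lift ord0 j) = tnth t j.
  by rewrite (tnth_nth a) (tnth_nth a t) /=.
have xE j : xat (behead x) j.+1 = xat x j.+2.
  by rewrite /xat /= nth_behead.
have x0 : xat x 1 = head 1 x by rewrite /xat nth0.
have x1 : head 1 (behead x) = xat x 2 by rewrite -nth0 nth_behead.
rewrite x0 x1.
rewrite [in RHS](eq_bigr (fun j : 'I_(size k) => (tnth t j)%:R ^+ kat k j.+1));
  last by move=> j _; rewrite tE.
rewrite [X in _ = _ * (_ * X)](eq_bigr (fun j : 'I_(size k) =>
  gbin (N%:R * xat (behead x) j.+2 - 1) (tnth t j) /
  gbin (N%:R * xat (behead x) j.+1 - 1) (tnth t j))); last first.
  by move=> j _; rewrite tE !xE.
by rewrite [kat _ 1]/= !mulrA; ring.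
Qed.

Lemma LiSh_nestLi k x : LiSh N k x = nestLi k x 0.
Proof. by rewrite nestLi_sum gbin0 mul1r. Qed.

(** * Linearity in the inner part *)

Definition nest_prefix (s : seq (nat * F)) (f : nat -> F) : nat -> F :=
  foldr (fun kx => nest kx.1 (N%:R * kx.2)) f s.

Lemma nestLi_cat k k' x x' m : size k = size x ->
  nestLi (k ++ k') (x ++ x') m = nest_prefix (zip k x) (nestLi k' x') m.
Proof.
elim: k x m => [|k1 k IH] [|x1 x] m //= [sz].
rewrite /nest; congr (_ * _); apply: eq_bigr => n _.
by rewrite IH.
Qed.

(** Linear relations are lists of pairs of a constant coefficient and a function, so that one lemma
    serves any number of terms. Only arguments below [N] occur in the sum. *)
Lemma nest_lincomb k (t : F) (cs : seq (F * (nat -> F))) m :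
  (forall n, (n < N)%N -> \sum_(c <- cs) c.1 * c.2 n = 0) ->
  \sum_(c <- cs) c.1 * nest k t c.2 m = 0.
Proof.
move=> cs0; rewrite /nest.
under eq_bigr do rewrite mulrCA mulr_sumr.
rewrite -mulr_sumr exchange_big big_nat big1 ?mulr0 // => n /andP[_ lt_nN] /=.
under eq_bigr do rewrite mulrCA.
by rewrite -mulr_sumr cs0 // mulr0.
Qed.

Lemma nest_prefix_lincomb s (cs : seq (F * (nat -> F))) :
  (forall n, (n < N)%N -> \sum_(c <- cs) c.1 * c.2 n = 0) ->
  forall n, (n < N)%N -> \sum_(c <- cs) c.1 * nest_prefix s c.2 n = 0.
Proof.
move=> cs0; elim: s => //= -[k x] s IH n _.
have := @nest_lincomb k (N%:R * x) [seq (c.1, nest_prefix s c.2) | c <- cs] n.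
rewrite big_map; apply => j lt_jN; rewrite big_map; exact: IH.
Qed.

(** * Shift and telescoping for a single entry *)

(** This trades a coefficient depending on the summation index for a lowered exponent, after which
    [nest_lincomb] applies. *)
Lemma nestM k (t : F) f m :
  nest k.+1 t (fun n => n%:R * f n) m = nest k t f m.
Proof.
congr (_ * _); apply: eq_big_nat => -[//|n] _.
rewrite exprS; move: (gbin _ _)^-1 (char0 n) (expf_neq0 k (char0 n)) => g n0 nk0.
by field; rewrite nk0 nat1r.
Qed.

(** By [gbin_pred] at [m] and at each [n], the factor t / C_t(n) becomes (t - n) / C_{t-1}(n), and
    (t - n) / n^(k+1) = t / n^(k+1) - 1 / n^k. *)
Lemma nest_shift k (t : F) f m : (forall j : nat, t != j%:R) ->
  (t - m%:R) * nest k.+1 (t + 1) f m = t * nest k.+1 t f m - nest k t f m.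
Proof.
move=> ht; rewrite /nest addrK mulrA gbin_pred.
rewrite -mulrA !(mulrCA t) -mulrBr; congr (_ * _).
rewrite !mulr_sumr -sumrB; apply: eq_big_nat => -[//|n] _.
have h0 := gbin_neq0 n.+1 ht; have h1 := gbin_pred_neq0 n.+1 ht.
have := gbin_pred t n.+1.
have h2 : t - n.+1%:R != 0 by rewrite subr_eq0 ht.
move/(canRL (mulKf h2)) => ->.
rewrite exprS; move: h1 h2 (ht 0%N) (char0 n) (expf_neq0 k (char0 n)) => /=.
move: n.+1%:R (n.+1%:R ^+ k) (gbin (t - 1) _) => q p g h1 h2 h3 h4 h5.
by field; rewrite h1 h5 h4 h2 h3.
Qed.

(** Summation by parts, with [P] and [Q] as tails of the sums of h(n) / C_{z-1}(n) and h(n) /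
    C_y(n). The condition on [P] at [N.-1] covers both a tail that vanishes there and the last
    position, where z = N and [P] is constantly 1. *)
Lemma nest0_telescope (y z : F) (h P Q : nat -> F) m :
  (forall j : nat, y != j%:R) -> z - y - 1 != 0 ->
  (forall n, (n.+1 < N)%N -> gbin (z - 1) n.+1 != 0) ->
  (forall n, (n.+1 < N)%N -> P n = h n.+1 / gbin (z - 1) n.+1 + P n.+1) ->
  (forall n, (n.+1 < N)%N -> Q n = h n.+1 / gbin y n.+1 + Q n.+1) ->
  (z - N%:R) * P N.-1 = 0 -> Q N.-1 = 0 -> (m < N)%N ->
  nest 0 y (fun n => gbin (z - 1) n * P n) m =
  ((y - m%:R) * (gbin y m * Q m) - (z - 1 - m%:R) * (gbin (z - 1) m * P m)) /
  (z - y - 1).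
Proof.
move=> hy hzy hz hP hQ PN QN lt_mN.
(* [T] is a primitive: T(n) - T(n+1) is the summand at n + 1. The factor of [P] is (v + 1 - b)
   C_u(b) / C_v(b) with u = z - 1, v = y - 1, b = n + 1, rewritten by [gbinS]; the term in [Q]
   absorbs the increments of [P]. *)
pose T n := (y * Q n - (z - 1 - n%:R) * (gbin (z - 1) n * P n) / gbin (y - 1) n)
            / (z - y - 1).
have TN : T N.-1 = 0.
  have -> : T N.-1 = (y * Q N.-1 - ((z - N%:R) * P N.-1) * gbin (z - 1) N.-1 /
                        gbin (y - 1) N.-1) / (z - y - 1).
    have -> : N%:R = 1 + N.-1%:R :> F by rewrite nat1r (ltn_predK lt_mN).
    by rewrite /T; congr (_ / _); ring.
  by rewrite PN QN; ring.
have hg := gbin_pred_neq0 _ hy.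
have TS n : (n.+1 < N)%N ->
  T n - T n.+1 = (n.+1%:R ^+ 0)^-1 / gbin (y - 1) n.+1 *
                 (gbin (z - 1) n.+1 * P n.+1).
  move=> lt_nN; rewrite expr0 invr1 mul1r /T hP // hQ //.
  have hy1 : y - n.+1%:R != 0 by rewrite subr_eq0.
  have hg' := hz _ lt_nN; have hgS := hg n.+1.
  (* All binomial coefficients are expressed through those of z - 1 and y - 1 at n + 1, which leaves
     an identity of rational functions. *)
  have g1 : gbin y n.+1 = y * gbin (y - 1) n.+1 / (y - n.+1%:R).
    by rewrite -gbin_pred mulrAC divff // mul1r.
  have g2 : gbin (y - 1) n = n.+1%:R * gbin (y - 1) n.+1 / (y - n.+1%:R).
    have -> : y - n.+1%:R = y - 1 - n%:R by rewrite -nat1r; ring.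
    by rewrite gbinS mulrAC divff ?mul1r // -addrA -opprD nat1r.
  have g3 : (z - 1 - n%:R) * gbin (z - 1) n = n.+1%:R * gbin (z - 1) n.+1.
    by rewrite gbinS.
  rewrite !(mulrA _ (gbin (z - 1) n)) g3 g1 g2.
  have := hy 0%N; have := char0 n; move: hy1 hg' hgS hzy.
  move: (h _) (P _) (Q _) (gbin (z - 1) _) (gbin (y - 1) _) => c1 c2 c3 c4 c5.
  have -> : z - 1 - n.+1%:R = z - y - 1 + (y - n.+1%:R) by ring.
  move: n.+1%:R => c6 h1 h2 h3 h4 h5 h6.
  by field; rewrite ?h1 ?h2 ?h3 ?h4 ?h5 ?h6.
rewrite /nest big_add1 (eq_big_nat _ _ (F2 := fun n => - (T n.+1 - T n))).
  rewrite sumrN telescope_sumr ?TN; last by rewrite -ltnS (ltn_predK lt_mN).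
  rewrite sub0r opprK /T mulrA; congr (_ / _).
  rewrite (mulrA (y - _)) gbin_pred; field; exact: hg.
by move=> n /andP[_ lt_nN]; rewrite opprB TS // -(ltn_predK lt_mN) ltnS.
Qed.

(* The counterpart of [LiSh_next], with value 0 when no entry is left. *)
Definition nestLi_head (t : F) (k : seq nat) (x : seq F) : nat -> F :=
  if k is k1 :: k' then nest k1 t (nestLi k' (behead x)) else fun=> 0.

(** For x_(r+1) = 1 the upper argument is a natural number, so [gbin_neq0] does not apply; the bound
    on [n] keeps each factor positive. *)
Lemma gbin_nat_neq0 n : (n < N)%N -> gbin (N%:R - 1 : F) n != 0.
Proof.
move=> lt_nN; rewrite /gbin mulf_neq0 ?invr_eq0 ?fact_neq0 //.
apply/prodf_neq0 => j _; have lt_jN := leq_ltn_trans (ltn_ord j) lt_nN.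
by rewrite -addrA -opprD nat1r -natrB ?(ltnW lt_jN) // -(subnSK lt_jN) char0.
Qed.

(** The tails in [nest0_telescope] are the inner sums with denominators C_{z-1} and C_y. The second
    belongs to an entry at y + 1, whence the shift of x_i by 1/N. *)
Lemma nest0_nest (y z : F) k f m :
  (forall j : nat, y != j%:R) -> z - y - 1 != 0 ->
  (forall n, (n.+1 < N)%N -> gbin (z - 1) n.+1 != 0) -> (m < N)%N ->
  nest 0 y (nest k z f) m =
  ((y - m%:R) * nest k (y + 1) f m - (z - 1 - m%:R) * nest k z f m) /
  (z - y - 1).
Proof.
move=> hy hzy hz lt_mN.
pose S (u : F) n := \sum_(n.+1 <= a < N) (a%:R ^+ k)^-1 / gbin u a * f a.
have SS u n : (n.+1 < N)%N ->
    S u n = (n.+1%:R ^+ k)^-1 * f n.+1 / gbin u n.+1 + S u n.+1.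
  by move=> lt_nN; rewrite /S big_ltn //; congr (_ + _); rewrite mulrAC.
have SN u : S u N.-1 = 0 by rewrite /S big_geq // (ltn_predK lt_mN).
have -> : nest k (y + 1) f m = gbin y m * S y m by rewrite /nest addrK.
apply: (@nest0_telescope y z (fun n => (n%:R ^+ k)^-1 * f n) (S (z - 1)) (S y));
  rewrite ?SN ?mulr0 // => n; exact: SS.
Qed.

Lemma nest0_nestLi (y : F) k x m : size k = size x ->
  let z := N%:R * head 1 x in
  (forall j : nat, y != j%:R) -> z - y - 1 != 0 ->
  (forall n, (n.+1 < N)%N -> gbin (z - 1) n.+1 != 0) -> (m < N)%N ->
  nest 0 y (nestLi k x) m =
  ((y - m%:R) * nestLi_head (y + 1) k x m - (z - 1 - m%:R) * nestLi k x m) /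
  (z - y - 1).
Proof.
case: k x => [|k1 k] [|x1 x] //= _ hy hzy hz lt_mN; last exact: nest0_nest.
rewrite mulr1 in hzy hz *.
(* No entry is left: z = N, and the inner function is C_{N-1} itself, so [P] is 1 and its increments
   [h] are 0. *)
have := @nest0_telescope y N%:R (fun=> 0) (fun=> 1) (fun=> 0) m hy hzy hz.
rewrite subrr mul0r mulr0 mulr1 => <- //; last 2 first.
- by move=> n _; rewrite mul0r add0r.
- by move=> n _; rewrite mul0r add0r.
by congr (_ * _); apply: eq_bigr => n _; rewrite mulr1.
Qed.

(** * Relations around the positions i-1 and i *)

Section Position.

Variables (kp k' : seq nat) (xp x' : seq F) (w y : F).
Hypotheses (szp : size kp = size xp) (sz' : size k' = size x').
Hypothesis N_gt0 : (0 < N)%N.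

(** These are N x_(i-1), N x_i and N x_(i+1); the default of [head] gives [Z] the value N at the
    last position. *)
Local Notation W := (N%:R * w).
Local Notation Y := (N%:R * y).
Local Notation Z := (N%:R * head 1 x').

Hypotheses (hw : forall j : nat, W != j%:R) (hy : forall j : nat, Y != j%:R).
Hypothesis hz : forall n, (n.+1 < N)%N -> gbin (Z - 1) n.+1 != 0.
Hypotheses (hzy : Z - Y - 1 != 0) (hzw : Z - W - 1 != 0) (hyw : Y - W != 0).

Local Notation L k x := (LiSh N (kp ++ k) (xp ++ x)).
Local Notation Lnext p :=
  (LiSh_next N (kp ++ p :: k') (xp ++ w :: y :: x') (size xp).+2).
Local Notation lift f := (nest_prefix (zip kp xp) f 0%N).
Local Notation y' := (y + N%:R^-1).

Lemma natN_neq0 : N%:R != 0 :> F.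
Proof. by rewrite -(prednK N_gt0) char0. Qed.

Lemma LiSh_cat k x : L k x = lift (nestLi k x).
Proof. by rewrite LiSh_nestLi nestLi_cat. Qed.

Lemma mul_shifted : N%:R * y' = Y + 1.
Proof. by field; exact: natN_neq0. Qed.

Lemma LiSh_nextE p : Lnext p = lift (nest p W (nestLi_head (Y + 1) k' x')).
Proof.
rewrite /LiSh_next /shifti xat_cat2 set_nth_cat2 size_cat -[X in (X < _)%N]addn2.
rewrite ltn_add2l /=.
case: k' x' sz' => [|k1 k''] [|x1 x''] //= _.
  (* Nothing follows position i, and both sides are 0: the one-term relation saying that the inner
     function vanishes is carried through the prefix. *)
  have := @nest_prefix_lincomb (zip kp xp) [:: (1, nest p W (fun=> 0))] _ 0%N N_gt0.
  rewrite !big_seq1 mul1r => -> // n _.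
  rewrite big_seq1 mul1r /= /nest big1 ?mulr0 // => j _; exact: mulr0.
rewrite -(cat_rcons w xp) -(size_rcons xp w) remi_cat2 (cat_rcons w xp).
by rewrite LiSh_cat /= mul_shifted.
Qed.

(** The coefficient t - m in [nest_shift] involves the index m at position i-1; its part m lowers
    the exponent there by [nestM]. *)
Lemma nest_shift_diff p q f n :
  Y * (nest p.+1 W (nest q.+1 (Y + 1) f) n - nest p.+1 W (nest q.+1 Y f) n) =
  nest p W (nest q.+1 (Y + 1) f) n - nest p.+1 W (nest q Y f) n.
Proof.
rewrite -[nest p W _ n]nestM; apply/eqP; rewrite -subr_eq0; apply/eqP.
(* The list is the claim with all terms on one side; the lemmas below follow the same pattern. *)
have := @nest_lincomb p.+1 W [:: (Y, nest q.+1 (Y + 1) f); (- Y, nest q.+1 Y f);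
  (-1, fun n => n%:R * nest q.+1 (Y + 1) f n); (1, nest q Y f)] n.
rewrite !big_cons !big_nil /= => lin; rewrite -[RHS]lin; first by ring.
move=> m _; rewrite !big_cons !big_nil /=.
have /eqP := nest_shift q f m hy.
by rewrite -subr_eq0 => /eqP h; rewrite -[RHS]h; ring.
Qed.

(** This is the first case of the theorem times x_i. As [p] and [q] may be 0, it also yields the
    indices with an entry 0 that the next lemmas remove. *)
Lemma LiSh_shift p q :
  Y * (L (p.+1 :: q.+1 :: k') (w :: y' :: x') -
       L (p.+1 :: q.+1 :: k') (w :: y :: x')) =
  L (p :: q.+1 :: k') (w :: y' :: x') - L (p.+1 :: q :: k') (w :: y :: x').
Proof.
rewrite !LiSh_cat /= mul_shifted; set f := nestLi _ _.
have := @nest_prefix_lincomb (zip kp xp)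
  [:: (Y, nest p.+1 W (nest q.+1 (Y + 1) f)); (- Y, nest p.+1 W (nest q.+1 Y f));
      (-1, nest p W (nest q.+1 (Y + 1) f)); (1, nest p.+1 W (nest q Y f))]
  _ 0%N N_gt0.
rewrite !big_cons !big_nil /= => lin; apply/eqP; rewrite -subr_eq0; apply/eqP.
rewrite -[RHS]lin; first by ring.
move=> m _; rewrite !big_cons !big_nil /=.
have /eqP := nest_shift_diff p q f m.
by rewrite -subr_eq0 => /eqP h; rewrite -[RHS]h; ring.
Qed.

(** An entry 0 at position i is summed by [nest0_nestLi]; the coefficients there involve the index
    at position i-1, which produces the terms with exponent [p]. *)
Lemma LiSh_right0 p :
  (Y + 1 - Z) * L (p.+1 :: 0%N :: k') (w :: y :: x') =
  (Z - 1) * L (p.+1 :: k') (w :: x') - L (p :: k') (w :: x')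
  - Y * Lnext p.+1 + Lnext p.
Proof.
rewrite !LiSh_cat !LiSh_nextE /=; set f := nestLi _ _; set g := nestLi_head _ _ _.
have := @nest_prefix_lincomb (zip kp xp)
  [:: (Y + 1 - Z, nest p.+1 W (nest 0 Y f)); (1 - Z, nest p.+1 W f);
      (1, nest p W f); (Y, nest p.+1 W g); (-1, nest p W g)] _ 0%N N_gt0.
rewrite !big_cons !big_nil /= => lin; apply/eqP; rewrite -subr_eq0; apply/eqP.
rewrite -[RHS]lin; first by ring.
move=> m _; rewrite !big_cons !big_nil /= -!(nestM p).
have := @nest_lincomb p.+1 W
  [:: (Y + 1 - Z, nest 0 Y f); (1 - Z, f);
      (1, fun n => n%:R * f n); (Y, g); (-1, fun n => n%:R * g n)] m.
rewrite !big_cons !big_nil /= => -> // n lt_nN.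
rewrite !big_cons !big_nil /= nest0_nestLi // -/f -/g.
by field.
Qed.

(** An entry 0 at position i-1 is summed by [nest0_nest] with z = Y + 1. This leaves sums at W + 1
    and Y + 1, which [nest_shift] brings back to W and Y at the cost of terms with exponent [q]. *)
Lemma LiSh_left0 q :
  (Y - W) * L (0%N :: q.+1 :: k') (w :: y' :: x') =
  W * L (q.+1 :: k') (w :: x') - L (q :: k') (w :: x')
  - Y * L (q.+1 :: k') (y :: x') + L (q :: k') (y :: x').
Proof.
rewrite !LiSh_cat /= mul_shifted; set f := nestLi _ _.
have := @nest_prefix_lincomb (zip kp xp)
  [:: (Y - W, nest 0 W (nest q.+1 (Y + 1) f)); (- W, nest q.+1 W f);
      (1, nest q W f); (Y, nest q.+1 Y f); (-1, nest q Y f)] _ 0%N N_gt0.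
rewrite !big_cons !big_nil /= => lin; apply/eqP; rewrite -subr_eq0; apply/eqP.
rewrite -[RHS]lin; first by ring.
move=> m lt_mN; rewrite !big_cons !big_nil /= nest0_nest //; last 2 first.
- by rewrite (_ : _ - _ = Y - W) //; ring.
- by move=> n _; rewrite addrK gbin_neq0.
rewrite [Y + 1 - 1]addrK.
rewrite [(W - _) * _]nest_shift // [(Y - m%:R) * _]nest_shift //.
field.
by rewrite (_ : _ - _ = Y - W) //; ring.
Qed.

(* Both sides are, up to the same factor, the second divided difference, at Y, W
   and Z - 1, of the boundary terms given by [nest0_nestLi]. *)
Lemma LiSh_exchange0 :
  (Y + 1 - Z) * (L (0%N :: k') (y :: x') - L (0%N :: k') (w :: x')) =
  (Y - W) * (Lnext 0 - L (0%N :: k') (w :: x')).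
Proof.
rewrite !LiSh_cat !LiSh_nextE /=; set f := nestLi _ _; set g := nestLi_head _ _ _.
have := @nest_prefix_lincomb (zip kp xp)
  [:: (Y + 1 - Z, nest 0 Y f); (Z - W - 1, nest 0 W f); (W - Y, nest 0 W g)]
  _ 0%N N_gt0.
rewrite !big_cons !big_nil /= => lin; apply/eqP; rewrite -subr_eq0; apply/eqP.
rewrite -[RHS]lin; first by ring.
move=> n lt_nN; rewrite !big_cons !big_nil /=.
rewrite !nest0_nestLi // -/f -/g.
(* If an entry is left, [g] is a nested sum at Y + 1 and [nest0_nest] applies; otherwise both sides
   are 0. *)
have -> : nest 0 W g n = ((W - n%:R) * nestLi_head (W + 1) k' x' n -
                         (Y - n%:R) * g n) / (Y - W).
  rewrite /g; case: k' x' => [|k1 k''] x'' /=.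
    by rewrite /nest big1 ?mulr0 ?subrr ?mul0r // => j _; exact: mulr0.
  rewrite nest0_nest ?addrK //.
  - by rewrite (_ : Y + 1 - W - 1 = Y - W) //; ring.
  - by rewrite (_ : Y + 1 - W - 1 = Y - W) //; ring.
  - by move=> j _; rewrite gbin_neq0.
by field; rewrite hyw hzw hzy.
Qed.

(** * The four difference quotients *)

Local Notation D k := (diffq N (LiSh N (kp ++ k)) (xp ++ w :: y :: x') (size xp).+2).

Lemma diffq_splitE k : D k = N%:R * (L k (w :: y' :: x') - L k (w :: y :: x')).
Proof. by rewrite /diffq /shifti xat_cat2 set_nth_cat2. Qed.

Lemma y_neq0 : y != 0.
Proof. by apply: contraNneq (hy 0) => ->; rewrite mulr0. Qed.

Lemma yw_neq0 : y - w != 0.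
Proof. by apply: contraNneq hyw => yw; rewrite -mulrBr yw mulr0. Qed.

Lemma scaled_yz_neq0 : Y + 1 - Z != 0.
Proof. by rewrite (_ : Y + 1 - Z = - (Z - Y - 1)) ?oppr_eq0 //; ring. Qed.

Lemma yz_neq0 : y' - head 1 x' != 0.
Proof.
apply: contraNneq hzy => yz.
have -> : Z - Y - 1 = - (N%:R * (y' - head 1 x')) by field; exact: natN_neq0.
by rewrite yz mulr0 oppr0.
Qed.

Lemma diffq_LiSh_SS p q :
  D (p.+1 :: q.+1 :: k') =
  1 / y * (L (p :: q.+1 :: k') (w :: y' :: x') -
           L (p.+1 :: q :: k') (w :: y :: x')).
Proof.
by rewrite diffq_splitE -LiSh_shift //; field; exact: y_neq0.
Qed.

Lemma diffq_LiSh_S1 p :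
  D (p.+1 :: 1%N :: k') =
  1 / y * (L (p :: 1%N :: k') (w :: y' :: x') + L (p.+1 :: k') (w :: x'))
  - 1 / (y' - head 1 x') * (L (p.+1 :: k') (w :: x') - Lnext p.+1)
  - N%:R^-1 * (1 / (y * (y' - head 1 x'))) * (Lnext p - L (p :: k') (w :: x')).
Proof.
rewrite diffq_LiSh_SS.
have hyz := scaled_yz_neq0.
have -> : L (p.+1 :: 0%N :: k') (w :: y :: x') =
  ((Z - 1) * L (p.+1 :: k') (w :: x') - L (p :: k') (w :: x')
  - Y * Lnext p.+1 + Lnext p) / (Y + 1 - Z).
  by rewrite -LiSh_right0 // mulrAC divff ?mul1r.
move: yz_neq0 natN_neq0 y_neq0 hyz; move: (LiSh N _ _) (LiSh N _ _).
move: (LiSh N _ _) (LiSh_next _ _ _ _) (LiSh_next _ _ _ _).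
move=> A1 A2 A3 A4 A5 h1 h2 h3 h4.
have e : y * N%:R + 1 + - head 1 x' * N%:R = Y + 1 - Z by ring.
by field; rewrite e h2 h3 h4.
Qed.

Lemma diffq_LiSh_1S q :
  D (1%N :: q.+1 :: k') =
  - (1 / (y - w)) * (L (q.+1 :: k') (y :: x') - L (q.+1 :: k') (w :: x'))
  - 1 / y * (L (q.+1 :: k') (w :: x') + L (1%N :: q :: k') (w :: y :: x'))
  - N%:R^-1 * (1 / (y * (y - w))) *
    (L (q :: k') (w :: x') - L (q :: k') (y :: x')).
Proof.
rewrite diffq_LiSh_SS.
have -> : L (0%N :: q.+1 :: k') (w :: y' :: x') =
  (W * L (q.+1 :: k') (w :: x') - L (q :: k') (w :: x')
  - Y * L (q.+1 :: k') (y :: x') + L (q :: k') (y :: x')) / (Y - W).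
  by rewrite -LiSh_left0 // mulrAC divff ?mul1r.
move: yw_neq0 natN_neq0 y_neq0 hyw.
move: (LiSh N _ _) (LiSh N _ _) (LiSh N _ _) (LiSh N _ _) (LiSh N _ _).
move=> A1 A2 A3 A4 A5 h1 h2 h3 h4.
by field; rewrite h1 h2 h3.
Qed.

Lemma diffq_LiSh_11 :
  D (1%N :: 1%N :: k') =
  - (1 / (y - w)) * (L (1%N :: k') (y :: x') - L (1%N :: k') (w :: x'))
  - 1 / (y' - head 1 x') * (L (1%N :: k') (w :: x') - Lnext 1%N).
Proof.
rewrite diffq_LiSh_1S.
have hyz := scaled_yz_neq0.
have -> : L (1%N :: 0%N :: k') (w :: y :: x') =
  ((Z - 1) * L (1%N :: k') (w :: x') - L (0%N :: k') (w :: x')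
  - Y * Lnext 1 + Lnext 0) / (Y + 1 - Z).
  by rewrite -LiSh_right0 // mulrAC divff ?mul1r.
(* Three values with an entry 0 remain; the exchange relation expresses one through the other two,
   which then cancel. *)
have -> : Lnext 0 = (Y + 1 - Z) * (L (0%N :: k') (y :: x') - L (0%N :: k') (w :: x'))
                    / (Y - W) + L (0%N :: k') (w :: x').
  by rewrite LiSh_exchange0 // mulrAC divff ?mul1r ?subrK.
move: yz_neq0 yw_neq0 natN_neq0 y_neq0 hyz hyw.
move: (LiSh N _ _) (LiSh N _ _) (LiSh N _ _) (LiSh N _ _) (LiSh_next _ _ _ _).
move=> A1 A2 A3 A4 A5 h1 h2 h3 h4 h5 h6.
have e : y * N%:R + 1 + - head 1 x' * N%:R = Y + 1 - Z by ring.
by field; rewrite e h2 h3 h4 h5.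
Qed.

End Position.

End NestedSums.

(** * Non-vanishing in the field of rational functions *)

(** One rational point separating the polynomials suffices; the non-vanishing lemmas below amount to
    choosing it. *)
Lemma tofrac_neq r (p q : {mpoly rat[r]}) (v : 'I_r -> rat) :
  p.@[v] != q.@[v] -> tofrac p != tofrac q.
Proof. by apply: contraNneq => /eqP; rewrite tofrac_eq => /eqP ->. Qed.

Lemma frac_mpoly_char0 r n : n.+1%:R != 0 :> {fraction {mpoly rat[r]}}.
Proof.
rewrite -[n.+1%:R](rmorph_nat (@tofrac {mpoly rat[r]})) -[0]tofrac0.
apply: (@tofrac_neq _ _ _ (fun=> 0)).
by rewrite rmorph_nat rmorph0 Num.Theory.pnatr_eq0.
Qed.

Lemma size_indets r : size (indets r) = r.
Proof. by rewrite size_map size_enum_ord. Qed.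

Lemma xat_indets r (j : 'I_r) : xat (indets r) j.+1 = tofrac 'X_j.
Proof. by rewrite /xat (nth_map j) ?size_enum_ord //= nth_ord_enum. Qed.

Section Indeterminates.

Variables (N r : nat) (N_gt0 : (0 < N)%N).
Implicit Types (a b : 'I_r).
Local Notation X a := (tofrac ('X_a : {mpoly rat[r]})).

Let morphE := (rmorph_nat, rmorphM, rmorphB, rmorph1, rmorph0).
Let NQ : N%:R != 0 :> rat. Proof. by rewrite Num.Theory.pnatr_eq0 -lt0n. Qed.

Lemma indet_neq_nat a (j : nat) : N%:R * X a != j%:R.
Proof.
have -> : N%:R * X a = tofrac (N%:R * 'X_a) by rewrite !morphE.
rewrite -[j%:R](rmorph_nat (@tofrac {mpoly rat[r]})).
(* At this point N x_a takes the value j + 1. *)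
apply: (@tofrac_neq _ _ _ (fun=> j.+1%:R / N%:R)); rewrite !morphE /= ?mevalXU.
by rewrite mulrCA divff // mulr1 Num.Theory.eqr_nat eqn_leq ltnn.
Qed.

Lemma indet_step_neq0 a b : N%:R * X a - N%:R * X b - 1 != 0.
Proof.
have -> : N%:R * X a - N%:R * X b - 1 = tofrac (N%:R * 'X_a - N%:R * 'X_b - 1).
  by rewrite !morphE.
rewrite -[0]tofrac0.
apply: (@tofrac_neq _ _ _ (fun=> 0)); rewrite !morphE /= ?mevalXU.
by rewrite mulr0 subrr sub0r oppr_eq0 oner_eq0.
Qed.

Lemma one_step_neq0 b : N%:R * 1 - N%:R * X b - 1 != 0.
Proof.
have -> : N%:R * 1 - N%:R * X b - 1 = tofrac (N%:R - N%:R * 'X_b - 1).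
  by rewrite !morphE mulr1.
rewrite -[0]tofrac0.
(* With all coordinates 1 the value is N - N - 1 = -1. *)
apply: (@tofrac_neq _ _ _ (fun=> 1)); rewrite !morphE /= ?mevalXU.
by rewrite mulr1 subrr sub0r oppr_eq0 oner_eq0.
Qed.

Lemma indet_sub_neq0 a b : a != b -> N%:R * X a - N%:R * X b != 0.
Proof.
move=> ab.
have -> : N%:R * X a - N%:R * X b = tofrac (N%:R * 'X_a - N%:R * 'X_b).
  by rewrite !morphE.
rewrite -[0]tofrac0.
apply: (@tofrac_neq _ _ _ (fun j => (j == a)%:R)); rewrite !morphE /= ?mevalXU.
by rewrite eqxx (eq_sym b) (negbTE ab) mulr1 mulr0 subr0.
Qed.

End Indeterminates.

(** * The four cases for the indeterminates *)

Theorem theorem3p2 (N r : nat) (k : r.-tuple nat) (i : nat)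
    (hN : (0 < N)%N) (hr : (1 < r)%N)
    (hk : forall j : 'I_r, (0 < tnth k j)%N)
    (hi : (1 < i <= r)%N) :
  let x := indets r in
  let xi := xat x i in
  let xp := xat x i.-1 in
  let xn := xat x i.+1 in
  let Ninv := N%:R^-1 in
  [/\ (1 < kat k i.-1)%N -> (1 < kat k i)%N ->
        diffq N (LiSh N k) x i =
          1 / xi * (LiSh N (deci k i.-1) (shifti N x i) - LiSh N (deci k i) x),
      (1 < kat k i.-1)%N -> kat k i = 1%N ->
        diffq N (LiSh N k) x i =
          1 / xi * (LiSh N (deci k i.-1) (shifti N x i)
                    + LiSh N (remi k i) (remi x i))
          - 1 / (xi + Ninv - xn) * (LiSh N (remi k i) (remi x i)
                                    - LiSh_next N (remi k i) x i)
          - Ninv * (1 / (xi * (xi + Ninv - xn)))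
            * (LiSh_next N (remi (deci k i.-1) i) x i
               - LiSh N (remi (deci k i.-1) i) (remi x i)),
      kat k i.-1 = 1%N -> (1 < kat k i)%N ->
        diffq N (LiSh N k) x i =
          - (1 / (xi - xp)) * (LiSh N (remi k i.-1) (remi x i.-1)
                               - LiSh N (remi k i.-1) (remi x i))
          - 1 / xi * (LiSh N (remi k i.-1) (remi x i) + LiSh N (deci k i) x)
          - Ninv * (1 / (xi * (xi - xp)))
            * (LiSh N (remi (deci k i) i.-1) (remi x i)
               - LiSh N (remi (deci k i) i.-1) (remi x i.-1))
    & kat k i.-1 = 1%N -> kat k i = 1%N ->
        diffq N (LiSh N k) x i =
          - (1 / (xi - xp)) * (LiSh N (remi k i.-1) (remi x i.-1)
                               - LiSh N (remi k i) (remi x i))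
          - 1 / (xi + Ninv - xn) * (LiSh N (remi k i) (remi x i)
                                    - LiSh_next N (remi k i) x i)].
Proof.
move=> x xi xp xn Ninv.
have /andP[lt1i le_ir] := hi.
have c0 n : n.+1%:R != 0 :> {fraction {mpoly rat[r]}} := frac_mpoly_char0 r n.
have lt_i2 : (i.-2 < r)%N by lia.
have lt_i1 : (i.-1 < r)%N by lia.
have xiE : xi = tofrac 'X_(Ordinal lt_i1).
  by rewrite -xat_indets /= prednK // ltnW.
have xpE : xp = tofrac 'X_(Ordinal lt_i2).
  by rewrite -xat_indets /= /xp; congr xat; lia.
have hxi j : N%:R * xi != j%:R by rewrite xiE indet_neq_nat.
have hxp j : N%:R * xp != j%:R by rewrite xpE indet_neq_nat.
have hip : N%:R * xi - N%:R * xp != 0.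
  by rewrite xiE xpE indet_sub_neq0 // -val_eqE /=; lia.
(* For i = r the entry x_(i+1) is the default 1 and not an indeterminate, so the non-vanishing
   conditions need separate arguments. *)
have xn_cases : xn = 1 \/ exists a, xn = tofrac 'X_a.
  case: (ltnP i r) => [lt_ir|le_ri]; last first.
    by left; rewrite /xn /xat nth_default // size_indets.
  by right; exists (Ordinal lt_ir); rewrite -xat_indets.
have hz n : (n.+1 < N)%N -> gbin (N%:R * xn - 1) n.+1 != 0.
  case: xn_cases => [-> lt_nN|[a ->] _]; first by rewrite mulr1 gbin_nat_neq0.
  by apply: (gbin_pred_neq0 c0) => j; exact: indet_neq_nat.
have hni a : N%:R * xn - N%:R * tofrac 'X_a - 1 != 0.
  by case: xn_cases => [->|[b ->]]; [exact: one_step_neq0 | exact: indet_step_neq0].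
have hnxi : N%:R * xn - N%:R * xi - 1 != 0 by rewrite xiE; exact: hni.
have hnxp : N%:R * xn - N%:R * xp - 1 != 0 by rewrite xpE; exact: hni.
have kpos j : (0 < j <= r)%N -> (0 < kat k j)%N.
  case: j => // j lt_jr; have := hk (Ordinal lt_jr).
  by rewrite (tnth_nth 0%N).
have kp0 : (0 < kat k i.-1)%N by apply: kpos; lia.
have ki0 : (0 < kat k i)%N by apply: kpos; lia.
have xE : x = take i.-2 x ++ xp :: xi :: drop i x.
  by apply: seq_split2; rewrite size_indets.
have kE : tval k = take i.-2 k ++ kat k i.-1 :: kat k i :: drop i k.
  by apply: seq_split2; rewrite size_tuple.
have xnE : xn = head 1 (drop i x) by rewrite -nth0 nth_drop addn0.
have iE : i = (size (take i.-2 x)).+2.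
  by rewrite size_takel ?size_indets; lia.
have szp : size (take i.-2 k) = size (take i.-2 x).
  by rewrite !size_takel ?size_indets ?size_tuple //; lia.
have szd : size (drop i k) = size (drop i x).
  by rewrite !size_drop size_indets size_tuple.
rewrite -/xn xE kE.
move: (take i.-2 x) (drop i x) (take i.-2 k) (drop i k) xnE iE szp szd.
move=> s s' t t' xnE iE szp szd.
(* Positivity lets the two exponents be written [p.+1] and [q.+1]; exponent 1 then means [p] or [q]
   equal to 0. *)
move: (kat k i.-1) (kat k i) kp0 ki0 => [//|p] [//|q] _ _.
rewrite xnE in hz hnxi hnxp *; rewrite {}iE -[(size s).+2.-1]/(size s).+1.
have kat1 a l : kat (t ++ a :: l) (size s).+1 = a by rewrite -szp kat_cat1.
have kat2 a b l : kat (t ++ a :: b :: l) (size s).+2 = b.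
  by rewrite -szp kat_cat2.
have dec1 a l : deci (t ++ a :: l) (size s).+1 = t ++ a.-1 :: l.
  by rewrite /deci kat1 -szp set_nth_cat1.
have dec2 a b l : deci (t ++ a :: b :: l) (size s).+2 = t ++ a :: b.-1 :: l.
  by rewrite /deci kat2 -szp set_nth_cat2.
have rem1 a l : remi (t ++ a :: l) (size s).+1 = t ++ l.
  by rewrite -szp remi_cat1.
have rem2 a b l : remi (t ++ a :: b :: l) (size s).+2 = t ++ a :: l.
  by rewrite -szp remi_cat2.
rewrite !(dec1, dec2) !(rem1, rem2) !(kat1, kat2) !remi_cat1 !remi_cat2.
rewrite /shifti xat_cat2 set_nth_cat2 /Ninv.
clear -c0 hN hxi hxp hz hnxi hnxp hip szp szd; clearbody xi xp.
split.
- move=> _ _; exact: (diffq_LiSh_SS c0 _ _ _ szp hN hxi).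
- move=> _ [->]; exact: (diffq_LiSh_S1 c0 _ szp szd hN hxi hz hnxi).
- move=> [->] _; exact: (diffq_LiSh_1S c0 _ _ szp hN hxp hxi hip).
- move=> [->] [->]; exact: (diffq_LiSh_11 c0 szp szd hN hxp hxi hz hnxi hnxp hip).
Qed.
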